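(* Let $n\ge 2$ be an integer and let $\Omega_n\subset\mathbb{R}^{n^3}$ be the polytope of $n\times n\times n$ stochastic tensors. Let $f_0(\Omega_n)$ denote the number of vertices of $\Omega_n$. Then $$f_0(\Omega_n)\le \binom{n^3-\lfloor \frac{(n-1)^3+1}{2}\rfloor}{3n^2-3n+1}+\binom{n^3-\lfloor \frac{(n-1)^3+2}{2}\rfloor}{3n^2-3n+1}.$$
   Context: An $n\times n\times n$ stochastic tensor is a real array $A=(a_{ijk})_{1\le i,j,k\le n}$ with $a_{ijk}\ge 0$ for all $i,j,k$, and $\sum_{i=1}^n a_{ijk}=1$ for all $j,k$, $\sum_{j=1}^n a_{ijk}=1$ for all $i,k$, $\sum_{k=1}^n a_{ijk}=1$ for all $i,j$. The set $\Omega_n$ of all such tensors, viewed as a subset of $\mathbb{R}^{n^3}$, is a convex polytope; its vertices are its extreme points. *)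

(* Defs.v *)
From mathcomp Require Import all_boot all_order all_algebra.
From mathcomp Require Import reals.
Set Implicit Arguments. Unset Strict Implicit. Unset Printing Implicit Defensive.
Import Order.TTheory GRing.Theory Num.Theory.
Local Open Scope ring_scope.

Definition tensor (R : realType) (n : nat) := {ffun 'I_n * 'I_n * 'I_n -> R}.

Definition stochastic (R : realType) (n : nat) (A : tensor R n) : Prop :=
  [/\ (forall i j k, 0 <= A (i, j, k)),
      (forall j k, \sum_(i < n) A (i, j, k) = 1),
      (forall i k, \sum_(j < n) A (i, j, k) = 1) &
      (forall i j, \sum_(k < n) A (i, j, k) = 1)].

Definition vertex_Omega (R : realType) (n : nat) (A : tensor R n) : Prop :=
  stochastic A /\
  forall (B C : tensor R n) (t : R),
    stochastic B -> stochastic C -> 0 < t < 1 ->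
    (forall x, A x = t * B x + (1 - t) * C x) -> B = A /\ C = A.

(* Main.v *)
(* McMullen's upper bound for simplicial polytopes, in the dual form "number of
   vertices against number of facets", by the method of Alon and Kalai but
   without assuming that the polytope is simple.  Let a polytope be given by
   x >= 0 in an affine subspace of dimension d of R^m, and let c be a linear
   functional separating the vertices.  At a vertex v choose d vanishing
   coordinates N_v that parametrize the subspace, let B_v be their complement,
   and write c x = c v + sum_(k in N_v) e_k x_k.  If c w < c v then some k in N_v
   with e_k < 0 has w_k > 0, so Dn_v = {k in N_v | e_k < 0} meets B_w, although
   it is disjoint from B_v; likewise for Up_v = {k | e_k > 0} and c w > c v.
   By the skew form of Bollobas's theorem, at most C(a + m - d, m - d) vertices
   have |Dn_v| <= a, and the same holds for Up_v.  Since |Dn_v| + |Up_v| <= d,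
   each vertex has |Dn_v| <= floor(d/2) or |Up_v| <= floor((d-1)/2).  For
   stochastic tensors m = n^3, and d = (n-1)^3 because the tensors with zero
   line sums have as basis the products of three vectors e_a - e_0. *)
Require Import Defs.
From mathcomp Require Import all_boot all_order all_algebra.
From mathcomp Require Import reals zify ring.
Set Implicit Arguments. Unset Strict Implicit. Unset Printing Implicit Defensive.
Import Order.TTheory GRing.Theory Num.Theory.
Local Open Scope ring_scope.

(** * The skew Bollobas inequality, by the rank of a matrix *)

(* Expand the product of the [b] values of [p j]: grouping the terms by multiset of
   exponents factors the matrix through the multisets of size [b] in [0 .. a]. *)
Lemma rank_prod_bound (F : fieldType) (I J : finType) (a b : nat)
    (u : I -> 'I_b -> F) (p : J -> {poly F}) :
  (forall j, size (p j) <= a.+1)%N ->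
  (\rank (\matrix_(i < #|I|, j < #|J|)
      \prod_(k < b) (p (enum_val j)).[u (enum_val i) k])%R <= 'C(a + b, b))%N.
Proof.
move=> sz_p.
pose S := [set t : b.-tuple 'I_a.+1 | sorted leq [seq val x | x <- t]].
have cS : #|S| = 'C(a + b, b) by rewrite card_sorted_tuples addnC.
rewrite -cS.
pose srt (f : {ffun 'I_b -> 'I_a.+1}) : b.-tuple 'I_a.+1 :=
  sort_tuple (relpre val leq) [tuple f k | k < b].
have srtS f : srt f \in S.
  by rewrite inE /= sorted_map; apply: sort_sorted => x y; apply: leq_total.
pose X : 'M[F]_(#|I|, #|S|) := \matrix_(i, t)
  \sum_(f | srt f == enum_val t) \prod_k u (enum_val i) k ^+ f k.
pose Y : 'M[F]_(#|S|, #|J|) := \matrix_(t, j)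
  \prod_(x <- (enum_val t : b.-tuple 'I_a.+1)) (p (enum_val j))`_x.
suff -> : \matrix_(i < #|I|, j < #|J|)
      \prod_(k < b) (p (enum_val j)).[u (enum_val i) k] = X *m Y.
  by apply: leq_trans (mxrankM_maxl _ _) (rank_leq_col _).
apply/matrixP=> i j; rewrite !mxE.
under eq_bigr => k _ do rewrite (horner_coef_wide _ (sz_p _)).
rewrite bigA_distr_bigA /=.
rewrite (partition_big srt [in S]) /=; last by move=> f _; exact: srtS.
rewrite big_enum_val /=; apply: eq_bigr => t _.
rewrite !mxE mulr_suml; apply: eq_bigr => f /eqP <-.
rewrite big_split /= mulrC; congr (_ * _).
rewrite (perm_big [tuple f k | k < b]) /=; last by rewrite perm_sort.
by rewrite big_map big_enum.
Qed.

(** Place [T] at distinct rationals [t x]; the product [m i j] of all [t x - t z] with [x] in [B i]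
    and [z] in [A j] vanishes exactly when [A j] meets [B i]. So this matrix has full rank [#|I|],
    while [rank_prod_bound] caps its rank. *)
Lemma skew_bollobas (disp : Order.disp_t) (C : orderType disp)
    (T I : finType) (h : I -> C) (A B : I -> {set T}) (a b : nat) :
  injective h ->
  (forall i, #|A i| <= a)%N -> (forall i, #|B i| = b) ->
  (forall i, [disjoint A i & B i]) ->
  (forall i j, (h i < h j)%O -> ~~ [disjoint A j & B i]) ->
  (#|I| <= 'C(a + b, b))%N.
Proof.
move=> inj_h cA cB dAB ndAB.
pose t (x : T) : rat := (enum_rank x)%:R.
have inj_t : injective t by move=> x y /eqP; rewrite eqr_nat => /eqP/val_inj/enum_rank_inj.
pose p i := \prod_(z in A i) ('X - (t z)%:P).
pose u i (k : 'I_b) := t (enum_val (cast_ord (esym (cB i)) k)).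
have sz_p i : (size (p i) <= a.+1)%N.
  by rewrite /p -big_enum size_prod_XsubC ltnS -cardE.
pose m i j := \prod_(k < b) (p j).[u i k].
have mE i j : m i j = \prod_(x in B i) \prod_(z in A j) (t x - t z).
  rewrite big_enum_val /m (reindex (cast_ord (cB i))) /=; last first.
    by exists (cast_ord (esym (cB i))) => k _; rewrite ?cast_ordK ?cast_ordKV.
  apply: eq_bigr => k _; rewrite /p /u cast_ordK horner_prod.
  by apply: eq_bigr => z _; rewrite hornerXsubC.
have m0 i j : (m i j == 0) = ~~ [disjoint A j & B i].
  rewrite mE; apply/idP/idP.
    rewrite prodf_seq_eq0 => /hasP[x _ /andP[xB]].
    rewrite prodf_seq_eq0 => /hasP[z _ /andP[zA]].
    rewrite subr_eq0 => /eqP/inj_t xz; apply/pred0Pn; exists x.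
    by rewrite /= xB xz zA.
  case/pred0Pn=> x /andP[/= xA xB].
  by rewrite (bigD1 x) //= (bigD1 x) //= subrr !mul0r.
apply: leq_trans (rank_prod_bound u sz_p).
set M := (X in (_ <= \rank X)%N).
suff /eqP rM : row_free M by rewrite leq_eqVlt rM eqxx.
(* [M] is triangular with nonzero diagonal for the order given by [h]. *)
apply: inj_row_free => v vM; apply/rowP=> i0; rewrite mxE.
apply/eqP/negPn/negP => vi0.
have vi0' : v 0 (enum_rank (enum_val i0)) != 0 by rewrite enum_valK.
pose P i := v 0 (enum_rank i) != 0.
(* With [h i] maximal on the support of [v], only the diagonal term survives in column [i] of
   [v *m M = 0]. *)
case: (Order.TotalTheory.arg_maxP (P := P) h vi0') => i vi max_i.
have := congr1 (fun w : 'rV_ _ => w 0 (enum_rank i)) vM.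
rewrite !mxE (bigD1 (enum_rank i)) //= big1 ?addr0 => [/eqP|k neq_ki].
  rewrite !mxE !enum_rankK mulf_eq0 (negPf vi) /= -/(m _ _) m0.
  by rewrite dAB.
rewrite !mxE enum_rankK.
have [->|vk] := eqVneq (v 0 k) 0; first by rewrite mul0r.
have Pk : P (enum_val k) by rewrite /P enum_valK.
have lt_ki : (h (enum_val k) < h i)%O.
  rewrite Order.POrderTheory.lt_neqAle [X in _ && X]max_i // andbT.
  by apply: contraNneq neq_ki => /inj_h <-; rewrite enum_valK.
by apply/eqP; rewrite mulf_eq0 -/(m _ _) m0 ndAB ?orbT.
Qed.

(** * Counting the vertices of a polytope *)

(** Pair vectors with a point [(1, t, t^2, ...)] of the moment curve, where [t] avoids the finitely
    many roots of the differences of their polynomials. *)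
Lemma exists_separating_functional (F : numFieldType) (m : nat)
    (s : seq 'rV[F]_m) :
  exists c : 'cV[F]_m, {in s &, injective (mulmx^~ c)}.
Proof.
pose Q := \prod_(v <- s) \prod_(w <- s | w != v) (rVpoly v - rVpoly w).
have Q0 : Q != 0.
  rewrite prodf_seq_neq0; apply/allP=> v _ /=; rewrite prodf_seq_neq0.
  apply/allP=> w _; apply/implyP; apply: contraNneq => /eqP.
  by rewrite subr_eq0 => /eqP/(can_inj rVpolyK) ->.
have [t Qt] : exists t : F, ~~ root Q t.
  pose r : seq F := [seq i%:R | i <- iota 0 (size Q)].
  have ur : uniq r by rewrite map_inj_uniq ?iota_uniq // => i j /eqP; rewrite eqr_nat => /eqP.
  have : ~~ all (root Q) r.
    apply/negP => allr; have := max_poly_roots Q0 allr ur.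
    by rewrite size_map size_iota ltnn.
  by case/allPn=> t _; exists t.
pose c : 'cV[F]_m := \col_i t ^+ i.
have cE v : (v *m c) 0 0 = (rVpoly v).[t].
  rewrite (horner_coef_wide _ (size_poly _ _)) !mxE; apply: eq_bigr => i _.
  by rewrite coef_rVpoly_ord mxE.
exists c => v w vs ws vw; apply/eqP; rewrite eq_sym; apply: contraNT Qt => neq.
rewrite /root /Q horner_prod (big_rem v) //= horner_prod.
rewrite (big_rem w) //= neq.
by rewrite hornerD hornerN -!cE [v *m c]vw subrr !mul0r.
Qed.

(** The columns of [W] in [Z] have rank [d], so [d] of them form an invertible [U]. For
    [z = y *m W], [colsub g z = y *m U] recovers [y], whence [e = U^-1 W c]. *)
Lemma exists_coordinate_basis (F : fieldType) (d m : nat) (W : 'M[F]_(d, m))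
    (Z : {set 'I_m}) :
  (forall y : 'rV_d, {in Z, forall j, (y *m W) 0 j = 0} -> y = 0) ->
  exists2 g : 'I_d -> 'I_m, injective g /\ (forall k, g k \in Z) &
    forall c : 'cV_m, exists e : 'cV_d,
      forall z : 'rV_m, (z <= W)%MS -> z *m c = colsub g z *m e.
Proof.
move=> W_inj; pose A := rowsub (@enum_val _ (mem Z)) W^T.
have fullA : row_full A.
  rewrite /row_full -mxrank_tr; apply: inj_row_free => y yA; apply: W_inj => j jZ.
  have := congr1 (fun w : 'rV_ _ => w 0 (enum_rank_in jZ j)) yA.
  rewrite !mxE => yA0; rewrite -[RHS]yA0; apply: eq_bigr => k _.
  by rewrite !mxE enum_rankK_in.
pose g k := enum_val (fullrankfun fullA k).
exists g; first split.
- by move=> k l /enum_val_inj/fullrankfun_inj.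
- by move=> k; apply: enum_valP.
move=> c; pose U := colsub g W.
have unitU : U \in unitmx.
  rewrite -unitmx_tr; suff -> : U^T = rowsub (fullrankfun fullA) A by exact: fullrowsub_unit.
  by apply/matrixP=> i j; rewrite !mxE.
exists (invmx U *m (W *m c)) => _ /submxP[y ->].
have -> : colsub g (y *m W) = y *m U.
  by apply/matrixP=> i j; rewrite !mxE; apply: eq_bigr => k _; rewrite mxE.
by rewrite mulmxA mulmxK ?mulmxA.
Qed.


(* The vertices of the polytope cut out by [v >= 0] in an affine space with
   direction the row space of [W]; the last hypothesis says that [v] is a vertex. *)
Lemma vertex_count_bound (F : realFieldType) (d m : nat) (W : 'M[F]_(d, m))
    (s : seq 'rV[F]_m) :
  (0 < d)%N -> uniq s ->
  {in s, forall v : 'rV_m, forall j, 0 <= v 0 j} ->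
  {in s &, forall v w : 'rV_m, (w - v <= W)%MS} ->
  {in s, forall v : 'rV_m, forall y : 'rV_d,
     (forall j, v 0 j = 0 -> (y *m W) 0 j = 0) -> y = 0} ->
  (size s <= 'C(m - (d + 1) %/ 2, m - d) + 'C(m - (d + 2) %/ 2, m - d))%N.
Proof.
move=> d_gt0 us s_ge0 sW s_vertex.
have [c inj_c] := exists_separating_functional s.
pose v (i : 'I_(size s)) := tnth (in_tuple s) i.
have vs i : v i \in s by apply: mem_tnth.
pose h i := (v i *m c) 0 0.
have inj_h : injective h.
  move=> i j hij; apply/val_inj/eqP.
  rewrite -(nth_uniq 0 (ltn_ord i) (ltn_ord j) us); apply/eqP.
  rewrite -!(tnth_nth 0 (in_tuple s)); apply: inj_c => //.
  by apply/matrixP=> x y; rewrite !ord1.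
(* [(ge i).1] lists the nonbasic coordinates at [v i], [(ge i).2] their reduced
   costs; no nondegeneracy is needed for the expansion of [h j]. *)
have [ge [ge_inj ge_v ge_h]] : exists ge : 'I_(size s) -> ('I_d -> 'I_m) * 'cV[F]_d,
    [/\ forall i, injective (ge i).1, forall i k, v i 0 ((ge i).1 k) = 0
      & forall i j, h j = h i + \sum_k v j 0 ((ge i).1 k) * (ge i).2 k 0].
  suff /fin_all_exists[ge geP] : forall i, exists ge : ('I_d -> 'I_m) * 'cV[F]_d,
    [/\ injective ge.1, forall k, v i 0 (ge.1 k) = 0
      & forall j, h j = h i + \sum_k v j 0 (ge.1 k) * ge.2 k 0].
    by exists ge; split=> i; case: (geP i).
  move=> i; pose Z := [set j | v i 0 j == 0].
  have [|g [g_inj gZ] gP] := @exists_coordinate_basis _ _ _ W Z.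
    move=> y yZ; apply: s_vertex (vs i) _ _ => j vj.
    by apply: yZ; rewrite inE vj.
  have {}gZ k : v i 0 (g k) = 0 by have := gZ k; rewrite inE => /eqP.
  have [e eP] := gP c; exists (g, e); split=> // j.
  apply/eqP; rewrite addrC -subr_eq; apply/eqP.
  have -> : h j - h i = ((v j - v i) *m c) 0 0.
    by rewrite mulmxBl [RHS]mxE [X in _ = _ + X]mxE.
  rewrite (eP _ (sW _ _ (vs i) (vs j))) mxE.
  by apply: eq_bigr => k _; rewrite !mxE gZ subr0.
pose g i := (ge i).1; pose e i k := (ge i).2 k 0.
pose B i := ~: (g i @: [set: 'I_d]).
have cgT i : #|g i @: [set: 'I_d]| = d.
  by rewrite card_imset ?cardsT ?card_ord //; apply: ge_inj.
have cB i : #|B i| = (m - d)%N by rewrite cardsCs setCK cgT card_ord.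
have inB i j k : v j 0 (g i k) != 0 -> g i k \in B j.
  by apply: contraR; rewrite inE negbK => /imsetP[l _ ->]; apply/eqP/ge_v.
pose Dn i := [set k | e i k < 0]; pose Up i := [set k | 0 < e i k].
have disjB i (K : {set 'I_d}) : [disjoint g i @: K & B i].
  by rewrite -setI_eq0 -setDE setD_eq0 imsetS ?subsetT.
have meet_dn i j : h i < h j -> ~~ [disjoint g j @: Dn j & B i].
  move=> hij; apply/negP => /pred0P dis; move: hij; apply/negP.
  rewrite -leNgt (ge_h j i) lerDl; apply: sumr_ge0 => k _.
  have [e_lt0|e_ge0] := ltP (e j k) 0; last by rewrite mulr_ge0 ?s_ge0.
  have -> : v i 0 (g j k) = 0; last by rewrite mul0r.
  apply/eqP/negPn/negP => /inB gB.
  by have := dis (g j k); rewrite /= gB imset_f // inE.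
have meet_up i j : h j < h i -> ~~ [disjoint g j @: Up j & B i].
  move=> hij; apply/negP => /pred0P dis; move: hij; apply/negP.
  rewrite -leNgt (ge_h j i) gerDl; apply: sumr_le0 => k _.
  have [e_le0|e_gt0] := leP (e j k) 0; first by rewrite mulr_ge0_le0 ?s_ge0.
  have -> : v i 0 (g j k) = 0; last by rewrite mul0r.
  apply/eqP/negPn/negP => /inB gB.
  by have := dis (g j k); rewrite /= gB imset_f // inE.

have cDU i : (#|Dn i| + #|Up i| <= d)%N.
  rewrite -cardsUI (_ : _ :&: _ = set0) ?cards0 ?addn0.
    by rewrite -[X in (_ <= X)%N]card_ord max_card.
  by apply/setP=> k; rewrite !inE; case: ltgtP.
(* The bound is the floor of [d / 2]; when [P i] fails, [cDU] leaves at most [d - (d + 2) %/ 2]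
   elements for [Up i]. *)
pose P i := (#|Dn i| <= d - (d + 1) %/ 2)%N.
(* A vertex gives [d <= m] through its injective [g], which makes the truncated subtractions
   exact. *)
have [s0|s_gt0] := posnP (size s); first by rewrite s0.
have d_le_m : (d <= m)%N.
  rewrite -(cgT (Ordinal s_gt0)) -[X in (_ <= X)%N](card_ord m).
  exact: max_card.
have <- : (d - (d + 1) %/ 2 + (m - d) = m - (d + 1) %/ 2)%N by lia.
have <- : (d - (d + 2) %/ 2 + (m - d) = m - (d + 2) %/ 2)%N by lia.
rewrite -[X in (X <= _)%N]card_ord -(cardC P); apply: leq_add.
  rewrite -(card_sig P).
  apply: (skew_bollobas (h := h \o val) (A := fun i => g (val i) @: Dn (val i))
    (B := fun i => B (val i))) => //.
  - by move=> i j /inj_h/val_inj.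
  - by move=> i; rewrite card_imset; [apply: (valP i) | apply: ge_inj].
  - by move=> i j; apply: meet_dn.
rewrite -(card_sig (predC P)).
(* [meet_up] is the skew condition for the reversed order, hence the sign. *)
apply: (skew_bollobas (h := fun i => - h (val i))
  (A := fun i => g (val i) @: Up (val i)) (B := fun i => B (val i))) => //.
- by move=> i j /oppr_inj/inj_h/val_inj.
- move=> i; rewrite card_imset; last exact: ge_inj.
  move: (valP i) (cDU (val i)); rewrite /= /P -ltnNge.
  by move: #|Dn _| #|Up _| => x y; lia.
- by move=> i j; rewrite ltrN2; apply: meet_up.
Qed.

(** * A basis of the tensors with zero line sums *)

Definition zero_line_sums (R : nmodType) (n : nat)
    (z : 'I_n * 'I_n * 'I_n -> R) : Prop :=
  [/\ forall j k, \sum_i z (i, j, k) = 0, forall i k, \sum_j z (i, j, k) = 0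
    & forall i j, \sum_k z (i, j, k) = 0].

Definition root_vector (R : pzRingType) (n : nat) (a : 'I_n) (i : 'I_n.+1) : R :=
  (i == lift ord0 a)%:R - (i == ord0)%:R.

Lemma sum_root_vector (R : pzRingType) (n : nat) (a : 'I_n) :
  \sum_i root_vector R a i = 0.
Proof.
rewrite sumrB (bigD1 (lift ord0 a)) //= eqxx big1 => [|i /negPf -> //].
by rewrite (bigD1 ord0) //= big1 => [|i /negPf -> //]; rewrite !addr0 subrr.
Qed.

Lemma root_vector_lift (R : pzRingType) (n : nat) (a b : 'I_n) :
  root_vector R a (lift ord0 b) = (a == b)%:R.
Proof.
by rewrite /root_vector (inj_eq lift_inj) [b == a]eq_sym [_ == ord0]eq_sym eq_liftF subr0.
Qed.

Lemma root_vector_expansion (R : pzRingType) (n : nat) (f : 'I_n.+1 -> R) :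
  \sum_i f i = 0 ->
  forall i, f i = \sum_a f (lift ord0 a) * root_vector R a i.
Proof.
rewrite big_ord_recl => /eqP; rewrite addr_eq0 => /eqP f0 i.
case: (unliftP ord0 i) => [b|] ->.
  rewrite (bigD1 b) //= root_vector_lift eqxx mulr1 big1 ?addr0 // => a /negPf ab.
  by rewrite root_vector_lift ab mulr0.
rewrite f0 -sumrN; apply: eq_bigr => a _.
by rewrite /root_vector eqxx eq_liftF sub0r mulrN1.
Qed.

Definition tensor_root (R : pzRingType) (n : nat) (a : 'I_n * 'I_n * 'I_n)
    (x : 'I_n.+1 * 'I_n.+1 * 'I_n.+1) : R :=
  root_vector R a.1.1 x.1.1 * root_vector R a.1.2 x.1.2 * root_vector R a.2 x.2.

Definition lift3 (n : nat) (a : 'I_n * 'I_n * 'I_n) :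
    'I_n.+1 * 'I_n.+1 * 'I_n.+1 :=
  (lift ord0 a.1.1, lift ord0 a.1.2, lift ord0 a.2).

Lemma tensor_root_zero_line_sums (R : pzRingType) (n : nat)
    (a : 'I_n * 'I_n * 'I_n) : zero_line_sums (tensor_root R a).
Proof.
split=> x y; rewrite /tensor_root /=.
- by rewrite -!mulr_suml sum_root_vector !mul0r.
- by rewrite -mulr_suml -mulr_sumr sum_root_vector mulr0 mul0r.
- by rewrite -mulr_sumr sum_root_vector mulr0.
Qed.

Lemma tensor_root_lift3 (R : pzRingType) (n : nat) (a b : 'I_n * 'I_n * 'I_n) :
  tensor_root R a (lift3 b) = (a == b)%:R.
Proof.
case: a b => [[a1 a2] a3] [[b1 b2] b3].
by rewrite /tensor_root /= !root_vector_lift !xpair_eqE -!natrM !mulnb.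
Qed.

(** A line with zero sum is determined by its entries off index 0; expand along the third, second
    and first index in turn. *)
Lemma tensor_root_expansion (R : pzRingType) (n : nat)
    (z : 'I_n.+1 * 'I_n.+1 * 'I_n.+1 -> R) :
  zero_line_sums z -> forall x, z x = \sum_a z (lift3 a) * tensor_root R a x.
Proof.
move=> [z1 z2 z3] [[i j] k].
rewrite (root_vector_expansion (f := fun k => z (i, j, k))) //.
rewrite -[RHS](pair_bigA _ (fun u v =>
  z (lift3 (u, v)) * tensor_root R (u, v) (i, j, k))) /=.
rewrite exchange_big; apply: eq_bigr => c _ /=.
rewrite (root_vector_expansion (f := fun j => z (i, j, lift ord0 c))) //.
rewrite -[RHS](pair_bigA _ (fun u v =>
  z (lift3 (u, v, c)) * tensor_root R (u, v, c) (i, j, k))) /=.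
rewrite exchange_big mulr_suml; apply: eq_bigr => b _ /=.
rewrite (root_vector_expansion (f := fun i => z (i, lift ord0 b, lift ord0 c))) //.
rewrite !mulr_suml; apply: eq_bigr => a _.
by rewrite /tensor_root /= !mulrA.
Qed.

(** * Vertices of the polytope of stochastic tensors *)

(** For large [M], [A] is the midpoint of the stochastic tensors [A + z / M] and [A - z / M]. *)
Lemma vertex_direction_eq0 (R : realType) (n : nat) (A : tensor R n.+1)
    (z : 'I_n.+1 * 'I_n.+1 * 'I_n.+1 -> R) :
  vertex_Omega A -> zero_line_sums z -> (forall x, A x = 0 -> z x = 0) ->
  forall x, z x = 0.
Proof.
move=> [[A_ge0 A1 A2 A3] A_ext] [z1 z2 z3] zA x.
have A_ge0' y : 0 <= A y by case: y => [[i j] k].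
(* Where [A y = 0] the quotient is 0 by convention, and [z y = 0] as well; elsewhere [M] exceeds
   [|z y| / A y]. *)
pose M := 1 + \sum_y `|z y| / A y.
have term_ge0 y : 0 <= `|z y| / A y by rewrite divr_ge0.
have M_gt0 : 0 < M by rewrite ltr_wpDr // sumr_ge0.
have zM y : `|z y / M| <= A y.
  have [A0|A_neq0] := eqVneq (A y) 0; first by rewrite zA // mul0r normr0 A0.
  rewrite normf_div (gtr0_norm M_gt0) ler_pdivrMr // mulrC -ler_pdivrMr; last first.
    by rewrite lt_def A_neq0 A_ge0'.
  by rewrite /M (bigD1 y) //= addrCA lerDl addr_ge0 // sumr_ge0.
have stoch (e : R) : e = 1 \/ e = -1 -> stochastic ([ffun y => A y + e * (z y / M)] : tensor R n.+1).
  move=> e1; have sum0 (f : 'I_n.+1 -> R) g :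
      \sum_i f i = 1 -> \sum_i g i = 0 -> \sum_i (f i + e * (g i / M)) = 1.
    by move=> f1 g0; rewrite big_split /= -mulr_sumr -mulr_suml f1 g0 mul0r mulr0 addr0.
  split=> [i j k|j k|i k|i j]; last 3 first.
  - by under eq_bigr do rewrite ffunE; apply: sum0.
  - by under eq_bigr do rewrite ffunE; apply: sum0.
  - by under eq_bigr do rewrite ffunE; apply: sum0.
  rewrite ffunE; have := zM (i, j, k); rewrite ler_norml => /andP[lo hi].
  by case: e1 => ->; rewrite ?mul1r ?mulN1r ?subr_ge0 // -lerBlDl sub0r.
have half01 : 0 < (2^-1 : R) < 1 by rewrite invr_gt0 invf_lt1 ?ltr1n ltr0n.
have [x0|+ _] := A_ext _ _ _ (stoch 1 (or_introl erefl)) (stoch (-1) (or_intror erefl)) half01.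
  by rewrite !ffunE; move: (_ / M) => w; field.
move=> /ffunP/(_ x); rewrite ffunE mul1r => /eqP; rewrite addrC -subr_eq0 addrK.
by rewrite mulf_eq0 invr_eq0 (gt_eqF M_gt0) orbF => /eqP.
Qed.

Theorem theorem2 (R : realType) (n : nat) (hn : (2 <= n)%N)
  (s : seq (tensor R n)) :
  uniq s -> (forall A, A \in s -> vertex_Omega A) ->
  (size s <=
     'C(n ^ 3 - ((n - 1) ^ 3 + 1) %/ 2, 3 * n ^ 2 - 3 * n + 1)
   + 'C(n ^ 3 - ((n - 1) ^ 3 + 2) %/ 2, 3 * n ^ 2 - 3 * n + 1))%N.
Proof.
case: n hn s => // n n_gt0 s us s_vertex; rewrite ltnS in n_gt0.
pose X := ('I_n.+1 * 'I_n.+1 * 'I_n.+1)%type; pose Y := ('I_n * 'I_n * 'I_n)%type.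
have cX : #|{: X}| = (n.+1 ^ 3)%N by rewrite !card_prod !card_ord !expnS expn0 muln1 mulnA.
have cY : #|{: Y}| = (n ^ 3)%N by rewrite !card_prod !card_ord !expnS expn0 muln1 mulnA.
pose W : 'M[R]_(#|{: Y}|, #|{: X}|) :=
  \matrix_(a, x) tensor_root R (enum_val a) (enum_val x).
pose vec (A : tensor R n.+1) : 'rV[R]_#|{: X}| := \row_x A (enum_val x).
have vecE A x : vec A 0 (enum_rank x) = A x by rewrite mxE enum_rankK.
have inj_vec : injective vec.
  by move=> A B AB; apply/ffunP=> x; rewrite -!vecE AB.
(* Here [n] is one less than in the statement, so [d = n ^ 3] and the lower binomial index is
   [m - d]. *)
have [-> ->] : (3 * n.+1 ^ 2 - 3 * n.+1 + 1 = n.+1 ^ 3 - n ^ 3 /\ n.+1 - 1 = n)%N.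
  by split; nia.
rewrite -(size_map vec) -cX -cY.
have yWE y x : (y *m W) 0 (enum_rank x) = \sum_a y 0 (enum_rank a) * tensor_root R a x.
  rewrite mxE (reindex enum_rank) /=; last exact/onW_bij/enum_rank_bij.
  by apply: eq_bigr => a _; rewrite mxE !enum_rankK.
apply: (vertex_count_bound (W := W)).
- by rewrite cY expn_gt0 n_gt0.
- by rewrite map_inj_uniq.
- move=> _ /mapP[A /s_vertex[[A_ge0 _ _ _] _] ->] x.
  by rewrite mxE; case: (enum_val x) => [[i j] k].
- move=> _ w /mapP[A /s_vertex[[_ A1 A2 A3] _] ->].
  move=> /mapP[B /s_vertex[[_ B1 B2 B3] _] ->{w}].
  have zAB : zero_line_sums (fun x => B x - A x).
    by split=> x y; rewrite sumrB ?A1 ?A2 ?A3 ?B1 ?B2 ?B3 subrr.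
  apply/submxP; exists (\row_a (fun x => B x - A x) (lift3 (enum_val a))).
  apply/rowP=> x; rewrite -(enum_valK x) yWE !mxE !enum_rankK.
  rewrite (tensor_root_expansion zAB); apply: eq_bigr => a _.
  by rewrite mxE enum_rankK.
move=> _ /mapP[A /s_vertex A_vertex ->] y yA.
pose z x := \sum_a y 0 (enum_rank a) * tensor_root R a x.
have z0 x : z x = 0.
  apply: (vertex_direction_eq0 A_vertex).
    split=> u v; rewrite exchange_big big1 //= => a _; rewrite -mulr_sumr;
    by case: (tensor_root_zero_line_sums R a) => r1 r2 r3; rewrite ?r1 ?r2 ?r3 mulr0.
  by move=> {}x Ax; rewrite /z -yWE; apply: yA; rewrite vecE.
(* The basis is dual to the entries at [lift3], so each coefficient of [y] is an entry of [z]. *)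
apply/rowP=> a; rewrite mxE -(z0 (lift3 (enum_val a))) /z (bigD1 (enum_val a)) //=.
rewrite tensor_root_lift3 eqxx mulr1 enum_valK big1 ?addr0 // => b /negPf ba.
by rewrite tensor_root_lift3 ba mulr0.
Qed.
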